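(* Let $A=\mathbb{F}_2[a,b,c]/(ab,bc)$, regarded as a graded $\mathbb{F}_2$-algebra with $a,b,c$ in degree one. Then $\mathrm{HH}^{3,-1}(A)=0$.
   Context: For a graded unital $\mathbb{F}_2$-algebra $A$ and a graded $A$-bimodule $M$, and for graded $\mathbb{F}_2$-vector spaces $N$ let $\underline{\mathrm{Hom}}_{\mathbb{F}_2}(N,M)$ be the graded vector space whose degree $s$ component consists of the degree-preserving linear maps $N\to M[s]$, where $M[s]^n=M^{s+n}$. The bigraded Hochschild cohomology $\mathrm{HH}^{n,s}(A,M)$ is the internal degree $s$ part of the $n$th cohomology of the cochain complex with $n$th term $\underline{\mathrm{Hom}}_{\mathbb{F}_2}(A^{\otimes n},M)$ and differential $$\partial(f)(a_1\otimes\cdots\otimes a_{n+1})=a_1f(a_2\otimes\cdots\otimes a_{n+1})+\sum_{i=1}^{n}f(a_1\otimes\cdots\otimes a_ia_{i+1}\otimes\cdots\otimes a_{n+1})+f(a_1\otimes\cdots\otimes a_n)a_{n+1}.$$ Equivalently, it is the cohomology of $\underline{\mathrm{Hom}}_{A^e}(B(A),M)$, where $B(A)$ is the bar resolution of $A$ and $A^e=A\otimes A^{\mathrm{op}}$. One writes $\mathrm{HH}^{n,s}(A)=\mathrm{HH}^{n,s}(A,A)$. *)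

(* Defs.v *)
From HB Require Import structures.
From mathcomp Require Import all_boot all_order all_algebra.
From mathcomp Require Import boolp functions.
From mathcomp Require Import mpoly.

Set Implicit Arguments.
Unset Strict Implicit.
Unset Printing Implicit Defensive.

Import GRing.Theory.
Local Open Scope ring_scope.
Local Open Scope quotient_scope.

Section QuotientLmodule.
Variables (R : nzRingType) (V : lmodType R) (W : zmodClosed V).
Hypothesis scaleW : forall k : R, {in W, forall v, k *: v \in W}.
Local Notation Q := (Quotient.quot W).

Definition quot_scale (k : R) (x : Q) : Q := \pi_Q (k *: repr x).

Lemma pi_scale k (v : V) : \pi_Q (k *: v) = quot_scale k (\pi_Q v).
Proof.
apply/eqP; rewrite -Quotient.idealrBE -scalerBr scaleW //.
by rewrite Quotient.idealrBE reprK.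
Qed.

Fact quot_scalerA a b x : quot_scale a (quot_scale b x) = quot_scale (a * b) x.
Proof.
elim/quotW: x => v.
by rewrite -(pi_scale b) -(pi_scale a) -(pi_scale (a * b)) scalerA.
Qed.

Fact quot_scale1r : left_id 1 quot_scale.
Proof. by move=> x; rewrite /quot_scale scale1r reprK. Qed.

Fact quot_scalerDr : right_distributive quot_scale +%R.
Proof.
move=> k; elim/quotW => x; elim/quotW => y.
by rewrite -raddfD -(pi_scale k (x + y)) -(pi_scale k x) -(pi_scale k y)
  scalerDr raddfD.
Qed.

Fact quot_scalerDl x : {morph quot_scale^~ x : a b / a + b}.
Proof. by move=> a b; rewrite /quot_scale scalerDl raddfD. Qed.

Definition quot_lmodMixin := GRing.Zmodule_isLmodule.Build R Q
  quot_scalerA quot_scale1r quot_scalerDr quot_scalerDl.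

End QuotientLmodule.

(* [gr d] is the degree d component; the last two fields say that V is the
   direct sum of its components. *)
Record is_grading (V : lmodType 'F_2) (gr : int -> V -> Prop) : Prop := {
  grading0 : forall d, gr d 0;
  gradingP : forall d (k : 'F_2) x y, gr d x -> gr d y -> gr d (k *: x + y);
  grading_span : forall x, exists (s : seq int) (f : int -> V),
    (forall d, gr d (f d)) /\ x = \sum_(d <- s) f d;
  grading_free : forall (s : seq int) (f : int -> V), uniq s ->
    (forall d, gr d (f d)) -> \sum_(d <- s) f d = 0 ->
    forall d, d \in s -> f d = 0
}.

Record gralg := GrAlg {
  gralg_sort :> algType 'F_2;
  alg_deg : int -> gralg_sort -> Prop;
  alg_grading : is_grading alg_deg;
  alg_deg1 : alg_deg 0 1;
  alg_degM : forall d e x y,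
    alg_deg d x -> alg_deg e y -> alg_deg (d + e) (x * y)
}.

Record grbimod (A : gralg) := GrBimod {
  grbimod_sort :> lmodType 'F_2;
  lact : A -> grbimod_sort -> grbimod_sort;
  ract : grbimod_sort -> A -> grbimod_sort;
  lact_linearl : forall m, linear (lact^~ m);
  lact_linearr : forall a, linear (lact a);
  ract_linearl : forall a, linear (ract^~ a);
  ract_linearr : forall m, linear (ract m);
  lact1 : forall m, lact 1 m = m;
  ract1 : forall m, ract m 1 = m;
  lactA : forall a b m, lact a (lact b m) = lact (a * b) m;
  ractA : forall a b m, ract (ract m a) b = ract m (a * b);
  lract : forall a b m, ract (lact a m) b = lact a (ract m b);
  bimod_deg : int -> grbimod_sort -> Prop;
  bimod_grading : is_grading bimod_deg;
  lact_deg : forall d e a m,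
    alg_deg d a -> bimod_deg e m -> bimod_deg (d + e) (lact a m);
  ract_deg : forall d e a m,
    bimod_deg d m -> alg_deg e a -> bimod_deg (d + e) (ract m a)
}.

Section RegularBimodule.
Variable A : gralg.

Fact mulrl_linear (m : A) : linear (fun a : A => a * m).
Proof. by move=> k x y; rewrite mulrDl scalerAl. Qed.

Fact mulrr_linear (a : A) : linear (fun m : A => a * m).
Proof. by move=> k x y; rewrite mulrDr scalerAr. Qed.

Definition regbimod : grbimod A :=
  @GrBimod A (A : algType 'F_2) (fun a m => a * m) (fun m a => m * a)
    mulrl_linear mulrr_linear mulrl_linear mulrr_linear
    (@mul1r A) (@mulr1 A) (fun a b m => mulrA a b m)
    (fun a b m => esym (mulrA m a b)) (fun a b m => esym (mulrA a m b))
    (@alg_deg A) (@alg_grading A) (@alg_degM A)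
    (fun d e a m => @alg_degM A d e m a).

End RegularBimodule.

Section Hochschild.
Variables (A : gralg) (M : grbimod A).

Definition setarg (n : nat) (a : 'I_n -> A) (i : 'I_n) (x : A) : 'I_n -> A :=
  fun j => if j == i then x else a j.

(* A linear map out of the n-th tensor power of A is given by an n-linear map,
   f a = f (a_1 (x) ... (x) a_n).  As the degree d component of the tensor power
   is spanned by the a_1 (x) ... (x) a_n with a_i homogeneous of degree d_i and
   d_1 + ... + d_n = d, such a map is degree-preserving into M[s] exactly when
   the second clause holds. *)
Definition is_cochain (n : nat) (s : int) (f : ('I_n -> A) -> M) : Prop :=
  (forall (a : 'I_n -> A) (i : 'I_n) (k : 'F_2) (x y : A),
     f (setarg a i (k *: x + y)) = k *: f (setarg a i x) + f (setarg a i y)) /\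
  (forall (d : 'I_n -> int) (a : 'I_n -> A),
     (forall i, alg_deg (d i) (a i)) -> bimod_deg (s + \sum_i d i) (f a)).

(* [lift ord_max j] and [lift ord0 j] have values j and j.+1. *)
Definition contract (n : nat) (i : 'I_n) (a : 'I_n.+1 -> A) : 'I_n -> A :=
  fun j => if (j < i)%N then a (lift ord_max j)
           else if j == i then a (lift ord_max j) * a (lift ord0 j)
           else a (lift ord0 j).

Definition hdiff (n : nat) (f : ('I_n -> A) -> M) : ('I_n.+1 -> A) -> M :=
  fun a => lact (a ord0) (f (fun j => a (lift ord0 j)))
         + \sum_(i < n) f (contract i a)
         + ract (f (fun j => a (lift ord_max j))) (a ord_max).

Definition cocycle (n : nat) (s : int) : {pred (('I_n -> A) -> M)} :=
  fun f => `[< is_cochain s f /\ hdiff f = 0 >].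
Arguments cocycle : clear implicits.

Definition is_coboundary (s : int) (n : nat) : (('I_n -> A) -> M) -> Prop :=
  match n with
  | 0 => fun f => f = 0
  | m.+1 => fun f => exists2 g : ('I_m -> A) -> M, is_cochain s g & f = hdiff g
  end.

Lemma cochain0 n s : is_cochain s (0 : ('I_n -> A) -> M).
Proof.
split=> [a i k x y|d a _]; first by rewrite /= scaler0 addr0.
exact: (grading0 (bimod_grading M)).
Qed.

Lemma cochainP n s (k : 'F_2) (f g : ('I_n -> A) -> M) :
  is_cochain s f -> is_cochain s g -> is_cochain s (k *: f + g).
Proof.
move=> [fl fd] [gl gd]; split=> [a i l x y|d a da].
  by rewrite !fctE fl gl !scalerDr !scalerA (mulrC k l) addrACA.
exact: (gradingP (bimod_grading M) k (fd d a da) (gd d a da)).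
Qed.

Lemma hdiff_linear n : linear (@hdiff n).
Proof.
move=> k f g; apply/funext => a; rewrite /hdiff !fctE.
rewrite lact_linearr ract_linearl big_split /= -scaler_sumr !scalerDr.
by rewrite [RHS]addrACA; congr (_ + _); rewrite [RHS]addrACA.
Qed.

Fact cocycle_submod n s : submod_closed (cocycle n s).
Proof.
split=> [|k f g /asboolP[fc df] /asboolP[gc dg]].
  apply/asboolP; split; first exact: cochain0.
  by have := hdiff_linear (-1) (0 : ('I_n -> A) -> M) 0;
    rewrite scaler0 addr0 scaleN1r addNr.
apply/asboolP; split; first exact: cochainP.
by rewrite hdiff_linear df dg scaler0 addr0.
Qed.

HB.instance Definition _ n s :=
  GRing.isSubmodClosed.Build 'F_2 (('I_n -> A) -> M) (cocycle n s)
    (cocycle_submod n s).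

Record cocycles (n : nat) (s : int) := Cocycle {
  cocycle_val :> ('I_n -> A) -> M;
  cocycle_valP : cocycle_val \in cocycle n s
}.

HB.instance Definition _ n s := [isSub for @cocycle_val n s].
HB.instance Definition _ n s := [Choice of cocycles n s by <:].
HB.instance Definition _ n s :=
  [SubChoice_isSubLmodule of cocycles n s by <:].

Definition coboundary (n : nat) (s : int) : {pred cocycles n s} :=
  fun z => `[< is_coboundary s z >].
Arguments coboundary : clear implicits.

Fact coboundary_submod n s : submod_closed (coboundary n s).
Proof.
split=> [|k x y /asboolP + /asboolP]; first apply/asboolP.
  case: n => [|n] //=; exists 0; first exact: cochain0.
  by have := hdiff_linear (-1) (0 : ('I_n -> A) -> M) 0;
    rewrite scaler0 addr0 scaleN1r addNr.
case: n x y => [|n] x y /= Hx Hy; apply/asboolP => /=.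
  by rewrite Hx Hy scaler0 addr0.
case: Hx Hy => [f fc ->] [g gc ->]; exists (k *: f + g); first exact: cochainP.
by rewrite hdiff_linear.
Qed.

HB.instance Definition _ n s :=
  GRing.isSubmodClosed.Build 'F_2 (cocycles n s) (coboundary n s)
    (coboundary_submod n s).

Definition HH_bimod (n : nat) (s : int) := Quotient.quot (coboundary n s).

HB.instance Definition _ n s := GRing.Zmodule.on (HH_bimod n s).
HB.instance Definition _ n s : GRing.Zmodule_isLmodule 'F_2 (HH_bimod n s) :=
  quot_lmodMixin (fun k => @rpredZ 'F_2 _ (coboundary n s) k).

Lemma HH_bimod_eq0 n s :
  (forall x : HH_bimod n s, x = 0) <->
  (forall f : ('I_n -> A) -> M,
     is_cochain s f -> hdiff f = 0 -> is_coboundary s f).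
Proof.
have pi0 (z : cocycles n s) :
    (\pi_(HH_bimod n s) z == 0) = (z \in coboundary n s).
  by rewrite -[in RHS](subr0 z) Quotient.idealrBE raddf0.
split=> [H f fc df|H x].
  have fP : f \in cocycle n s by apply/asboolP.
  by have /eqP := H (\pi_(HH_bimod n s) (Cocycle fP)); rewrite pi0 => /asboolP.
elim/quotW: x => z; apply/eqP; rewrite pi0.
case: z => f fP; have /asboolP[fc df] := fP.
by apply/asboolP; apply: H.
Qed.

End Hochschild.

Arguments cocycle {A M} n s f.
Arguments coboundary {A M} n s z.

Definition HH (A : gralg) (n : nat) (s : int) : lmodType 'F_2 :=
  HH_bimod (regbimod A) n s.

Definition Xa : {mpoly 'F_2[3]} := 'X_(@Ordinal 3 0 isT).
Definition Xb : {mpoly 'F_2[3]} := 'X_(@Ordinal 3 1 isT).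
Definition Xc : {mpoly 'F_2[3]} := 'X_(@Ordinal 3 2 isT).

Definition ideal_ab_bc : {pred {mpoly 'F_2[3]}} :=
  fun p => `[< exists u v, p = u * (Xa * Xb) + v * (Xb * Xc) >].

Fact ideal_ab_bc_closed : idealr_closed ideal_ab_bc.
Proof.
split.
- by apply/asboolP; exists 0, 0; rewrite !mul0r addr0.
- apply/asboolP => -[u [v /(congr1 (meval (fun=> 0)))]].
  by rewrite rmorph1 rmorphD !rmorphM /= !mevalXU !mulr0 addr0 => /eqP.
- move=> w p q /asboolP[u [v ->]] /asboolP[u' [v' ->]]; apply/asboolP.
  exists (w * u + u'), (w * v + v').
  by rewrite mulrDr !mulrDl !mulrA addrACA.
Qed.

HB.instance Definition _ :=
  isIdealr.Build {mpoly 'F_2[3]} ideal_ab_bc ideal_ab_bc_closed.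

Fact ideal_ab_bc_scale (k : 'F_2) :
  {in ideal_ab_bc, forall p, k *: p \in ideal_ab_bc}.
Proof. by move=> p pI; rewrite -mul_mpolyC idealMr. Qed.

Definition quot_ab_bc := {ideal_quot ideal_ab_bc}.

HB.instance Definition _ := GRing.ComNzRing.on quot_ab_bc.
HB.instance Definition _ : GRing.Zmodule_isLmodule 'F_2 quot_ab_bc :=
  quot_lmodMixin ideal_ab_bc_scale.

Definition class_ab_bc : {mpoly 'F_2[3]} -> quot_ab_bc :=
  \pi_{ideal_quot ideal_ab_bc}.

Fact class_ab_bc_zmod : zmod_morphism class_ab_bc.
Proof. exact: (rmorphB (\pi_{ideal_quot ideal_ab_bc})). Qed.

Fact class_ab_bc_monoid : monoid_morphism class_ab_bc.
Proof. exact: (@pi_is_monoid_morphism _ _ _ {ideal_quot ideal_ab_bc}). Qed.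

Fact class_ab_bcZ : scalable class_ab_bc.
Proof. by move=> k p; apply: (pi_scale ideal_ab_bc_scale). Qed.

HB.instance Definition _ := GRing.isZmodMorphism.Build
  {mpoly 'F_2[3]} quot_ab_bc class_ab_bc class_ab_bc_zmod.
HB.instance Definition _ := GRing.isMonoidMorphism.Build
  {mpoly 'F_2[3]} quot_ab_bc class_ab_bc class_ab_bc_monoid.
HB.instance Definition _ := GRing.isScalable.Build
  'F_2 {mpoly 'F_2[3]} quot_ab_bc *:%R class_ab_bc class_ab_bcZ.

Lemma class_ab_bc_surj x : exists p, x = class_ab_bc p.
Proof.
by exists (repr (x : {ideal_quot ideal_ab_bc})); rewrite /class_ab_bc reprK.
Qed.

Lemma class_ab_bc_eq0 p : (class_ab_bc p == 0) = (p \in ideal_ab_bc).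
Proof.
rewrite -[in RHS](subr0 p) Quotient.idealrBE.
by rewrite -(raddf0 class_ab_bc).
Qed.

Fact quot_ab_bc_scalerAl (k : 'F_2) (x y : quot_ab_bc) :
  k *: (x * y) = k *: x * y.
Proof.
have [[p ->] [q ->]] := (class_ab_bc_surj x, class_ab_bc_surj y).
by rewrite -rmorphM -!class_ab_bcZ -rmorphM scalerAl.
Qed.

HB.instance Definition _ :=
  GRing.Lmodule_isLalgebra.Build 'F_2 quot_ab_bc quot_ab_bc_scalerAl.
HB.instance Definition _ :=
  GRing.Lalgebra_isComAlgebra.Build 'F_2 quot_ab_bc.

Definition deg_ab_bc (d : int) (x : quot_ab_bc) : Prop :=
  match d with
  | Posz e => exists2 p : {mpoly 'F_2[3]}, p \is e.-homog & x = class_ab_bc p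
  | Negz _ => x = 0
  end.

Lemma ideal_ab_bc_pihomog e p :
  p \in ideal_ab_bc -> pihomog mdeg e p \in ideal_ab_bc.
Proof.
suff H (m : {mpoly 'F_2[3]}) k : m \is k.-homog -> m \in ideal_ab_bc ->
    forall u, pihomog mdeg e (u * m) \in ideal_ab_bc.
  move=> /asboolP[u [v ->]]; rewrite raddfD rpredD //; apply: (H _ 2%N).
  - by apply: (@dhomogM _ _ _ 1 _ 1); rewrite dhomogX /= mdeg1.
  - by apply/asboolP; exists 1, 0; rewrite mul1r mul0r addr0.
  - by apply: (@dhomogM _ _ _ 1 _ 1); rewrite dhomogX /= mdeg1.
  - by apply/asboolP; exists 0, 1; rewrite mul1r mul0r add0r.
move=> mk mI u.
rewrite (@pihomog_partitionE _ _ mdeg _ u (leqnn _)).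
rewrite mulr_suml raddf_sum rpred_sum // => i _ /=.
have hi := dhomogM (pihomogP mdeg i u) mk.
have [ie|ie] := eqVneq (i + k)%N e.
  by rewrite pihomog_dE ?idealMr // -ie.
by rewrite (pihomog_ne0 ie hi) rpred0.
Qed.

Fact deg_ab_bc_grading : is_grading deg_ab_bc.
Proof.
split.
- by case=> [e|//]; exists 0; rewrite ?rpred0 ?raddf0.
- case=> [e|e] k x y /=; last by move=> -> ->; rewrite scaler0 addr0.
  move=> [p pe ->] [q qe ->]; exists (k *: p + q).
    by rewrite rpredD ?rpredZ.
  by rewrite linearP.
- move=> x; have [p ->] := class_ab_bc_surj x.
  pose n := mmeasure mdeg p.
  pose f d : quot_ab_bc := if d is Posz e
    then class_ab_bc (pihomog mdeg e p) else 0.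
  exists [seq Posz i | i <- iota 0 n], f; split.
    case=> [e|e] //=; exists (pihomog mdeg e p) => //.
    exact: pihomogP.
  rewrite big_map -{1}[n]subn0 -/(index_iota 0 n) big_mkord /= -raddf_sum.
  by congr class_ab_bc; apply: pihomog_partitionE.
- move=> s f us fd sf0 d ds.
  case: d ds => [e|e] ds; last exact: (fd (Negz e)).
  have /choice[q qP] d : exists p : {mpoly 'F_2[3]}, f d = class_ab_bc p /\
      (if d is Posz i then p \is i.-homog else p == 0).
    by case: d (fd d) => [i [p]|i /= ->]; [exists p | exists 0; rewrite raddf0].
  have: \sum_(d <- s) q d \in ideal_ab_bc.
    rewrite -class_ab_bc_eq0 raddf_sum /=.
    by under eq_bigr do rewrite -(qP _).1; rewrite sf0.
  move/(ideal_ab_bc_pihomog e); rewrite raddf_sum (bigD1_seq (Posz e)) //=.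
  rewrite big1 ?addr0 => [|d].
    by rewrite (qP e).1 pihomog_dE ?(qP e).2 // -class_ab_bc_eq0 => /eqP.
  case: d (qP d) => [i|i] [_ qi] ie; last by rewrite (eqP qi) raddf0.
  by apply: pihomog_ne0 qi; apply: contraNneq ie => ->.
Qed.

Fact deg_ab_bc1 : deg_ab_bc 0 1.
Proof. by exists 1; rewrite ?dhomog1 ?rmorph1. Qed.

Fact deg_ab_bcM d e x y :
  deg_ab_bc d x -> deg_ab_bc e y -> deg_ab_bc (d + e) (x * y).
Proof.
have z0 d' : deg_ab_bc d' 0 by exact: (grading0 deg_ab_bc_grading).
case: d => [d|d]; last by move=> /= -> _; rewrite mul0r.
case: e => [e|e]; last by move=> _ /= ->; rewrite mulr0.
move=> [p pd ->] [q qe ->]; exists (p * q); last by rewrite rmorphM.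
exact: dhomogM.
Qed.

Definition gralg_ab_bc : gralg :=
  GrAlg deg_ab_bc_grading deg_ab_bc1 deg_ab_bcM.

(* Main.v *)
Require Import Defs.
From HB Require Import structures.
From mathcomp Require Import all_boot all_order all_algebra.
From mathcomp Require Import boolp functions.
From mathcomp Require Import ssrcomplements mpoly zify ring.
Import GRing.Theory.
Local Open Scope ring_scope.

(* The algebra has the basis of normal words a^i c^j and b^k, coming from the
   quadratic Groebner basis ab, ba, bc, cb, ca - ac.  Hence, as for Anick's
   resolution, every 3-cocycle is cohomologous to a "reduced" one, which
   vanishes on (1, y, z), on (v, m, z) with v m normal and on (v1, v2, m) with
   v1 v2 not normal and v2 m normal, where v, v1, v2 are letters and m is a
   normal word.  A reduced cocycle is determined by its values on the eight
   words v1 v2 v3 with v1 v2 and v2 v3 among ab, ba, bc, cb, ca.  In internal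
   degree -1 these values are quadratic, and the cocycle condition becomes a
   linear system over F_2; each of its solutions is the coboundary of a
   2-cochain given by linear forms on the words ab, ba, bc, cb, ca. *)

(** * Normal words as a basis of the algebra *)

Local Notation Q := quot_ab_bc.

Lemma mpoly_linear_extension (R : nzRingType) n (V : lmodType R)
    (phi : 'X_{1..n} -> V) :
  exists L : {linear {mpoly R[n]} -> V}, forall m, L 'X_[m] = phi m.
Proof.
pose L (p : {mpoly R[n]}) := \sum_(m <- msupp p) p@_m *: phi m.
(* Supports change under addition, so the sums are first extended to all monomials of bounded
   degree, a range common to the polynomials compared. *)
have LE k p : (msize p <= k)%N ->
    L p = \sum_(m : 'X_{1..n < k}) p@_m *: phi m.
  move=> le_pk; rewrite /L.
  rewrite (big_mksub 'X_{1..n < k}) ?msupp_uniq //=; last first.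
    by move=> m /msize_mdeg_lt /leq_trans; apply.
  rewrite big_rmcond //= => m /memN_msupp_eq0 ->.
  by rewrite scale0r.
have Llin : linear L.
  move=> k p q; pose N := maxn (msize (k *: p + q)) (maxn (msize p) (msize q)).
  rewrite !(LE N) ?leq_max ?leqnn ?orbT //.
  rewrite scaler_sumr -big_split /=; apply: eq_bigr => m _.
  by rewrite mcoeffD mcoeffZ scalerDl scalerA.
pose L' : {linear {mpoly R[n]} -> V} :=
  HB.pack L (GRing.isLinear.Build _ _ _ _ L Llin).
exists L' => m.
by rewrite /= /L msuppX big_seq1 mcoeffX eqxx scale1r.
Qed.

(* Locked, since unification would otherwise compare them by unfolding the
   quotient of the polynomial ring. *)
HB.lock Definition xa : Q := class_ab_bc Xa.
HB.lock Definition xb : Q := class_ab_bc Xb.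
HB.lock Definition xc : Q := class_ab_bc Xc.

Lemma mul_ab : xa * xb = 0 :> Q.
Proof.
rewrite xa.unlock xb.unlock -rmorphM; apply/eqP; rewrite class_ab_bc_eq0.
by apply/asboolP; exists 1, 0; rewrite mul1r mul0r addr0.
Qed.

Lemma mul_bc : xb * xc = 0 :> Q.
Proof.
rewrite xb.unlock xc.unlock -rmorphM; apply/eqP; rewrite class_ab_bc_eq0.
by apply/asboolP; exists 0, 1; rewrite mul1r mul0r add0r.
Qed.

Lemma class_mono (m : 'X_{1..3}) : class_ab_bc 'X_[m] =
  xa ^+ m (inord 0) * xb ^+ m (inord 1) * xc ^+ m (inord 2).
Proof.
rewrite xa.unlock xb.unlock xc.unlock mpolyXE_id !big_ord_recl big_ord0 mulr1.
rewrite mulrA !rmorphM !rmorphXn /=.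
by do ! [congr (_ * _)]; congr (class_ab_bc 'X__ ^+ m _);
   apply/val_inj; rewrite /= inordK.
Qed.

Lemma mono_mul_ab (m : 'X_{1..3}) :
  (0 < m (inord 1))%N -> (0 < m (inord 0) + m (inord 2))%N ->
  class_ab_bc 'X_[m] = 0.
Proof.
rewrite class_mono; case: (m (inord 1)) => // k _.
case: (m (inord 0)) => [|i]; case: (m (inord 2)) => [|j] // _.
- by rewrite mul1r exprSr exprS mulrA -(mulrA _ xb) mul_bc mulr0 mul0r.
- by rewrite exprSr exprS mulrA -(mulrA _ xa) mul_ab mulr0 !mul0r.
- by rewrite exprSr exprS mulrA -(mulrA _ xa) mul_ab mulr0 !mul0r.
Qed.

(** Since ab = bc = 0, a monomial containing b together with another letter dies, so only the words
    a^i c^j and the positive powers of b survive. *)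
Lemma class_monoP (m : 'X_{1..3}) :
  [\/ class_ab_bc 'X_[m] = 0,
      exists i j, mdeg m = (i + j)%N /\ class_ab_bc 'X_[m] = xa ^+ i * xc ^+ j |
      exists k, mdeg m = k.+1 /\ class_ab_bc 'X_[m] = xb ^+ k.+1].
Proof.
have dm : mdeg m = (m (inord 0) + m (inord 1) + m (inord 2))%N.
  rewrite mdegE !big_ord_recl big_ord0 addn0 addnA.
  by do ! [congr (_ + _)%N]; congr (m _); apply/val_inj; rewrite /= inordK.
have [m1|m1] := posnP (m (inord 1)).
  constructor 2; exists (m (inord 0)), (m (inord 2)).
  by rewrite dm class_mono m1 addn0 mulr1.
have [m02|m02] := posnP (m (inord 0) + m (inord 2))%N; last first.
  by constructor 1; apply: mono_mul_ab.
constructor 3; exists (m (inord 1)).-1.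
rewrite dm class_mono !prednK //.
by move/eqP: m02; rewrite addn_eq0 => /andP[/eqP-> /eqP->]; rewrite mul1r mulr1 addn0.
Qed.

Lemma mono_ind (P : Q -> Prop) :
  P 0 -> (forall k x y, P x -> P y -> P (k *: x + y)) ->
  (forall i j, P (xa ^+ i * xc ^+ j)) -> (forall k, P (xb ^+ k.+1)) ->
  forall x, P x.
Proof.
move=> P0 PL Pac Pb x; have [p ->] := class_ab_bc_surj x.
elim/mpolyind: p => [|k m p _ _ IH]; first by rewrite raddf0.
rewrite raddfD /= linearZ; apply: PL => //=.
by have [->|[i [j [_ ->]]]|[l [_ ->]]] := class_monoP m.
Qed.

Lemma mono_ind_deg (n : nat) (P : Q -> Prop) :
  P 0 -> (forall k x y, P x -> P y -> P (k *: x + y)) ->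
  (forall i j, (i + j)%N = n -> P (xa ^+ i * xc ^+ j)) ->
  (forall k, k.+1 = n -> P (xb ^+ k.+1)) ->
  forall x, deg_ab_bc n x -> P x.
Proof.
move=> P0 PL Pac Pb x [p /dhomogP ph ->].
rewrite (mpolyE p) linear_sum big_seq; elim/big_ind : _ => // [y z Py Pz|m mp].
  by rewrite -[y]scale1r; apply: PL.
rewrite linearZ /= -[_ *: _]addr0; apply: PL => //.
have : mdeg m = n := ph _ mp.
have [->|[i [j [-> ->]]]|[l [-> ->]]] := class_monoP m => //=.
- exact: Pac.
- exact: Pb.
Qed.

(** This encodes the linear independence of the normal words. A linear map on polynomials that sends
    mixed monomials to 0 kills the ideal, hence descends along a section [s] of the quotient map.
    The index of [psi] is shifted because b^0 = 1 is already a^0 c^0. *)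
Lemma Q_linear_extension (V : lmodType 'F_2) (phi : nat -> nat -> V)
    (psi : nat -> V) :
  exists L : {linear Q -> V}, (forall i j, L (xa ^+ i * xc ^+ j) = phi i j) /\
    (forall k, L (xb ^+ k.+1) = psi k).
Proof.
pose Phi (m : 'X_{1..3}) :=
  if m (inord 1) == 0%N then phi (m (inord 0)) (m (inord 2))
  else if (m (inord 0) + m (inord 2) == 0)%N then psi (m (inord 1)).-1 else 0.
have [L LE] := mpoly_linear_extension _ _ V Phi.
have inord_eq i j : (i < 3)%N -> (j < 3)%N ->
    (inord i == inord j :> 'I_3) = (i == j).
  by move=> i3 j3; rewrite -val_eqE /= !inordK.
have L0 i (q : {mpoly 'F_2[3]}) : (i \in [:: inord 0; inord 2]) ->
    L (q * ('X_i * 'X_(inord 1))) = 0.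
  move=> iP; elim/mpolyind: q => [|k m p _ _ IH]; first by rewrite mul0r raddf0.
  rewrite mulrDl raddfD /= IH addr0 -scalerAl linearZ /= -!mpolyXD LE /Phi.
  rewrite !mnmDE !mnm1E eqxx !addnS /=.
  move: iP; rewrite !inE => /orP[]/eqP->; rewrite eqxx ?addnS ?addSn //=;
  by rewrite ?addnS ?addSn ?scaler0.
have I0 : Ordinal (n:=3) (m:=0) isT = inord 0 by apply/val_inj; rewrite /= inordK.
have I1 : Ordinal (n:=3) (m:=1) isT = inord 1 by apply/val_inj; rewrite /= inordK.
have I2 : Ordinal (n:=3) (m:=2) isT = inord 2 by apply/val_inj; rewrite /= inordK.
have Lid p : p \in ideal_ab_bc -> L p = 0.
  move=> /asboolP[u [v ->]]; rewrite raddfD /= /Xa /Xb /Xc I0 I1 I2.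
  by rewrite L0 ?(mulrC 'X_(inord 1)) ?L0 ?inE ?eqxx ?orbT ?addr0.
have [s sK] := choice class_ab_bc_surj.
have LsE p : L (s (class_ab_bc p)) = L p.
  apply/eqP; rewrite -subr_eq0 -raddfB /= Lid //.
  by rewrite -class_ab_bc_eq0 raddfB /= -sK subrr.
have Llin : linear (L \o s).
  move=> k x y; rewrite /= -linearP -[in RHS]LsE linearP /=.
  by rewrite -!sK.
pose L' : {linear Q -> V} :=
  HB.pack (L \o s) (GRing.isLinear.Build _ _ _ _ (L \o s) Llin).
exists L'; split=> [i j|k]; rewrite /L' /=.
  pose m : 'X_{1..3} := (U_(inord 0) *+ i + U_(inord 2) *+ j)%MM.
  have -> : xa ^+ i * xc ^+ j = class_ab_bc 'X_[m].
    by rewrite mpolyXD -!mpolyXn rmorphM !rmorphXn xa.unlock xc.unlock /Xa /Xc I0 I2.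
  rewrite LsE LE /Phi /m !mnmDE !mulmnE !mnm1E.
  by rewrite !inord_eq // !mul1n !mul0n !addn0.
pose m : 'X_{1..3} := (U_(inord 1) *+ k.+1)%MM.
have -> : xb ^+ k.+1 = class_ab_bc 'X_[m].
  by rewrite -!mpolyXn !rmorphXn xb.unlock /Xb I1.
rewrite LsE LE /Phi /m !mulmnE !mnm1E.
by rewrite !inord_eq // mul1n !mul0n.
Qed.

(** * Arithmetic modulo 2, degrees and linearity *)

Lemma two_eq0 : 2%:R = 0 :> Q.
Proof.
have : (2%:R : 'F_2) *: (1 : Q) = 0.
  by rewrite (_ : 2%:R = 0) ?scale0r //; apply/val_inj.
by rewrite scaler_nat.
Qed.

Lemma three_eq1 : 3%:R = 1 :> Q.
Proof. by rewrite (natrD Q 2 1) two_eq0 add0r. Qed.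

Lemma four_eq0 : 4%:R = 0 :> Q.
Proof. by rewrite (natrD Q 2 2) two_eq0 add0r. Qed.

Lemma five_eq1 : 5%:R = 1 :> Q.
Proof. by rewrite (natrD Q 4 1) four_eq0 add0r. Qed.

(* [ring:] only rewrites whole numeral coefficients, so reduction modulo 2
   needs one rule per numeral. *)
Ltac ring2 := ring: two_eq0 three_eq1 four_eq0 five_eq1.

Lemma addQ_eq0 (u v : Q) : u + v = 0 -> u = v.
Proof. by move=> uv; rewrite -[u]addr0 -[RHS]add0r -{2}uv; ring2. Qed.

Lemma deg_eq d e (x : Q) : d = e -> deg_ab_bc d x -> deg_ab_bc e x.
Proof. by move=> ->. Qed.

Lemma deg0 d : deg_ab_bc d 0.
Proof. exact: (grading0 deg_ab_bc_grading). Qed.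

Lemma degP d k x y :
  deg_ab_bc d x -> deg_ab_bc d y -> deg_ab_bc d (k *: x + y).
Proof. exact: (gradingP deg_ab_bc_grading). Qed.

Lemma degD d x y : deg_ab_bc d x -> deg_ab_bc d y -> deg_ab_bc d (x + y).
Proof. by move=> dx; rewrite -[x]scale1r; apply: degP. Qed.

Lemma deg_xa : deg_ab_bc 1%N xa.
Proof. by rewrite xa.unlock; exists Xa => //; rewrite dhomogX /= mdeg1. Qed.

Lemma deg_xb : deg_ab_bc 1%N xb.
Proof. by rewrite xb.unlock; exists Xb => //; rewrite dhomogX /= mdeg1. Qed.

Lemma deg_xc : deg_ab_bc 1%N xc.
Proof. by rewrite xc.unlock; exists Xc => //; rewrite dhomogX /= mdeg1. Qed.

Lemma degX (n : nat) (x : Q) : deg_ab_bc 1%N x -> deg_ab_bc n (x ^+ n).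
Proof.
move=> x1; elim: n => [|n IH]; first exact: deg_ab_bc1.
by rewrite exprS -addn1 addnC; apply: deg_ab_bcM x1 IH.
Qed.

Lemma deg_mono_ac i j : deg_ab_bc (i + j)%N (xa ^+ i * xc ^+ j).
Proof. by apply: deg_ab_bcM (degX _ _ deg_xa) (degX _ _ deg_xc). Qed.

Lemma deg_mono_b (k : nat) : deg_ab_bc k (xb ^+ k).
Proof. exact: degX deg_xb. Qed.

Lemma linear_at0 (h : Q -> Q) : linear h -> h 0 = 0.
Proof.
by move=> hlin; have := hlin (-1) 0 0; rewrite scaler0 addr0 scaleN1r addNr.
Qed.

Lemma linear_add (h h' : Q -> Q) : linear h -> linear h' ->
  linear (fun x => h x + h' x).
Proof. by move=> hl hl' k x y; rewrite hl hl' scalerDr addrACA. Qed.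

Lemma linear_mull (u : Q) (h : Q -> Q) : linear h -> linear (fun x => u * h x).
Proof. by move=> hl k x y; rewrite hl mulrDr -scalerAr. Qed.

Lemma linear_mulr (u : Q) (h : Q -> Q) : linear h -> linear (fun x => h x * u).
Proof. by move=> hl k x y; rewrite hl mulrDl -scalerAl. Qed.

Lemma deg_linear (h : Q -> Q) (s : int) : linear h ->
  (forall i j, deg_ab_bc (s + (i + j)%N) (h (xa ^+ i * xc ^+ j))) ->
  (forall k, deg_ab_bc (s + k.+1) (h (xb ^+ k.+1))) ->
  forall d x, deg_ab_bc d x -> deg_ab_bc (s + d) (h x).
Proof.
move=> hlin hac hb d x.
case: d => [n|n]; last by move=> /= ->; rewrite linear_at0 //; apply: deg0.
move: x; apply: mono_ind_deg.
- by rewrite linear_at0 //; apply: deg0.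
- by move=> k x y hx hy; rewrite hlin; apply: degP.
- by move=> i j <-.
- by move=> k <-.
Qed.

(** * Cochains of internal degree -1 as functions of two and three variables *)

Definition dbar2 (g : Q -> Q -> Q) (x y z : Q) : Q :=
  x * g y z + g (x * y) z + g x (y * z) + g x y * z.

(** Like [dbar2], this is the Hochschild differential in curried form; [hdiff2] and [hdiff3] make
    the match. *)
Definition dbar3 (f : Q -> Q -> Q -> Q) (x y z t : Q) : Q :=
  x * f y z t + f (x * y) z t + f x (y * z) t + f x y (z * t) + f x y z * t.

Record bicochain (g : Q -> Q -> Q) : Prop := Bicochain {
  bi_linl : forall y, linear (g^~ y);
  bi_linr : forall x, linear (g x);
  bi_deg : forall d e x y, deg_ab_bc d x -> deg_ab_bc e y ->
    deg_ab_bc (d + e - 1) (g x y)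
}.

Record tricochain (f : Q -> Q -> Q -> Q) : Prop := Tricochain {
  tri_lin1 : forall y z, linear (fun x => f x y z);
  tri_lin2 : forall x z, linear (fun y => f x y z);
  tri_lin3 : forall x y, linear (f x y);
  tri_deg : forall d e k x y z,
    deg_ab_bc d x -> deg_ab_bc e y -> deg_ab_bc k z ->
    deg_ab_bc (d + e + k - 1) (f x y z)
}.

Lemma tricochain_dbar2 g : bicochain g -> tricochain (dbar2 g).
Proof.
move=> [gl gr gd]; split.
- move=> y z; apply: linear_add; [apply: linear_add; [apply: linear_add|]|].
  + exact: linear_mulr.
  + by move=> k x x'; rewrite mulrDl -scalerAl gl.
  + exact: gl.
  + exact: linear_mulr.
- move=> x z; apply: linear_add; [apply: linear_add; [apply: linear_add|]|].
  + exact: linear_mull.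
  + by move=> k y y'; rewrite mulrDr -scalerAr gl.
  + by move=> k y y'; rewrite mulrDl -scalerAl gr.
  + exact: linear_mulr.
- move=> x y; apply: linear_add; [apply: linear_add; [apply: linear_add|]|].
  + exact: linear_mull.
  + exact: gr.
  + by move=> k z z'; rewrite mulrDr -scalerAr gr.
  + exact: linear_mull.
- move=> d e k x y z dx dy dz; have DM := deg_ab_bcM.
  rewrite /dbar2; do ! apply: degD.
  + by apply: deg_eq (DM _ _ _ _ dx (gd _ _ _ _ dy dz)); lia.
  + by apply: deg_eq (gd _ _ _ _ (DM _ _ _ _ dx dy) dz); lia.
  + by apply: deg_eq (gd _ _ _ _ dx (DM _ _ _ _ dy dz)); lia.
  + by apply: deg_eq (DM _ _ _ _ (gd _ _ _ _ dx dy) dz); lia.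
Qed.

Lemma bicochainD g g' : bicochain g -> bicochain g' ->
  bicochain (fun x y => g x y + g' x y).
Proof.
move=> [gl gr gd] [gl' gr' gd']; split=> [y|x|d e x y dx dy].
- exact: linear_add.
- exact: linear_add.
- by apply: degD; [apply: gd|apply: gd'].
Qed.

Lemma tricochainD f f' : tricochain f -> tricochain f' ->
  tricochain (fun x y z => f x y z + f' x y z).
Proof.
move=> [f1 f2 f3 fd] [f1' f2' f3' fd'].
split=> [y z|x z|x y|d e k x y z dx dy dz].
- exact: linear_add.
- exact: linear_add.
- exact: linear_add.
- by apply: degD; [apply: fd|apply: fd'].
Qed.

(** Once products are reassociated, the terms cancel in pairs because 2 = 0. *)
Lemma dbar3_dbar2 g x y z t : bicochain g -> dbar3 (dbar2 g) x y z t = 0.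
Proof.
move=> [gl gr _]; rewrite /dbar3 /dbar2 !mulrA; ring2.
Qed.

Lemma dbar3D f f' x y z t :
  dbar3 (fun x y z => f x y z + f' x y z) x y z t =
    dbar3 f x y z t + dbar3 f' x y z t.
Proof. rewrite /dbar3; ring. Qed.

Lemma dbar3_eq0 f x y z t : dbar3 f x y z t = 0 ->
  [/\ f (x * y) z t
      = x * f y z t + f x (y * z) t + f x y (z * t) + f x y z * t,
      f x (y * z) t
      = x * f y z t + f (x * y) z t + f x y (z * t) + f x y z * t &
      f x y (z * t)
      = x * f y z t + f (x * y) z t + f x (y * z) t + f x y z * t].
Proof.
by move=> H; split; apply: addQ_eq0; rewrite -[RHS]H /dbar3; ring.
Qed.

(** * Normalization at the unit *)

Definition normalized (f : Q -> Q -> Q -> Q) : Prop :=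
  [/\ forall y z, f 1 y z = 0, forall x z, f x 1 z = 0 & forall x y, f x y 1 = 0].

(** A coboundary first clears the values at (1, 1, y) and (y, 1, 1). The cocycle condition at (1, 1,
    y, z), (x, 1, 1, z) and (x, y, 1, 1) then clears the values with a single 1. *)
Lemma exists_normalizing f : tricochain f ->
  (forall x y z t, dbar3 f x y z t = 0) ->
  exists2 g, bicochain g & normalized (fun x y z => f x y z + dbar2 g x y z).
Proof.
move=> fc df.
(* The map [e] is the projection onto degree 0. *)
have [e [eac eb]] := Q_linear_extension Q
  (fun i j => if (i + j == 0)%N then 1 else 0) (fun=> 0).
have elin : linear e by move=> k x y; rewrite linearP.
have e1 : e 1 = 1 by have := eac 0 0; rewrite mulr1 /=.
have edeg d x : deg_ab_bc d x -> deg_ab_bc d (e x).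
  move=> dx; rewrite -[d]add0r; apply: deg_linear dx => // [i j|k].
    rewrite eac; case: eqP => [->|_]; [exact: deg_ab_bc1|exact: deg0].
  by rewrite eb; apply: deg0.
have edeg0 x : deg_ab_bc 0 (e x).
  elim/mono_ind: x => [|k x y ex ey|i j|k].
  - by rewrite raddf0; apply: deg0.
  - by rewrite elin; apply: degP.
  - by rewrite eac; case: eqP => _; [exact: deg_ab_bc1|exact: deg0].
  - by rewrite eb; apply: deg0.
have [f1 f2 f3 fd] := fc.
(* These values have degree -1, where the algebra is zero. *)
have f11 y : deg_ab_bc 0 y -> f 1 1 y = 0 /\ f y 1 1 = 0.
  move=> y0; split.
    exact: (fd 0 0 0 _ _ _ deg_ab_bc1 deg_ab_bc1 y0).
  exact: (fd 0 0 0 _ _ _ y0 deg_ab_bc1 deg_ab_bc1).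
(* The choice gives g(1, y) = f(1, 1, y) and g(y, 1) = f(y, 1, 1), since the other summand then lies
   in degree -1. *)
pose g x y := f (e x) 1 y + f x 1 (e y).
have gc : bicochain g.
  split=> [y k x x'|x k y y'|d d' x y dx dy]; rewrite /g.
  - by rewrite elin !f1 scalerDr addrACA.
  - by rewrite elin !f3 scalerDr addrACA.
  - by apply: degD; rewrite -[d]addr0; apply: fd => //;
      [exact: edeg|exact: deg_ab_bc1|exact: deg_ab_bc1|exact: edeg].
exists g => //.
set F := fun x y z : Q => _.
have dF x y z t : dbar3 F x y z t = 0.
  by rewrite /F dbar3D df dbar3_dbar2 // addr0.
have F11 y : F 1 1 y = 0.
  rewrite /F /dbar2 /g !mul1r e1 (f11 _ (edeg0 y)).1 (f11 _ deg_ab_bc1).1.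
  ring2.
have F_11 y : F y 1 1 = 0.
  rewrite /F /dbar2 /g !mulr1 e1 (f11 _ (edeg0 y)).2 (f11 _ deg_ab_bc1).1.
  ring2.
have F1 y z : F 1 y z = 0.
  have [_ _] := dbar3_eq0 _ _ _ _ _ (dF 1 1 y z).
  by rewrite !F11 !mul1r => H; rewrite -[LHS]addr0 {2}H; ring2.
have F2 x z : F x 1 z = 0.
  have [_ + _] := dbar3_eq0 _ _ _ _ _ (dF x 1 1 z).
  by rewrite F11 F_11 !mulr1 mul1r => ->; ring2.
split=> // x y.
have [+ _ _] := dbar3_eq0 _ _ _ _ _ (dF x y 1 1).
by rewrite !F_11 !mulr1 => H; rewrite -[LHS]addr0 {2}H; ring2.
Qed.

(** * Reduction of normalized cochains *)

Record reduced (f : Q -> Q -> Q -> Q) : Prop := Reduced {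
  red_1 : forall y z, f 1 y z = 0;
  red_a : forall i j z, f xa (xa ^+ i * xc ^+ j) z = 0;
  red_b : forall k z, f xb (xb ^+ k) z = 0;
  red_c : forall j z, f xc (xc ^+ j) z = 0;
  red_ab : forall k, f xa xb (xb ^+ k) = 0;
  red_cb : forall k, f xc xb (xb ^+ k) = 0;
  red_ba : forall i j, f xb xa (xa ^+ i * xc ^+ j) = 0;
  red_bc : forall j, f xb xc (xc ^+ j) = 0;
  red_ca : forall i j, f xc xa (xa ^+ i * xc ^+ j) = 0
}.

Section Reducing.
Variables (f : Q -> Q -> Q -> Q) (G_ab G_cb G_ba G_bc G_ca : Q).
Hypotheses (fc : tricochain f) (fn : normalized f).
Hypotheses (dG_ab : deg_ab_bc 1%N G_ab) (dG_cb : deg_ab_bc 1%N G_cb)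
  (dG_ba : deg_ab_bc 1%N G_ba) (dG_bc : deg_ab_bc 1%N G_bc)
  (dG_ca : deg_ab_bc 1%N G_ca).

Let f1 y z : f 1 y z = 0. Proof. by have [] := fn. Qed.
Let f2 x z : f x 1 z = 0. Proof. by have [] := fn. Qed.
Let f3 x y : f x y 1 = 0. Proof. by have [] := fn. Qed.

(** The value g(c, a^i c^j) forced by the vanishing of f + dbar2 g at (c, a, m) with m = a^(i-1)
    c^j. It is recursive because g(ca, m) = g(ac, m) contains the term a g(c, m). The parameter
    [G_ca] is the free value g(c, a), and g(c, c^j) is set to 0. *)
Fixpoint gamma_c_mono (i j : nat) : Q :=
  if i is i'.+1 then
    f xc xa (xa ^+ i' * xc ^+ j) + f xa xc (xa ^+ i' * xc ^+ j)
    + xa * gamma_c_mono i' j + G_ca * (xa ^+ i' * xc ^+ j)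
  else 0.

(** The values g(b, a m) and g(b, c^(j+1)) forced by vanishing at (b, a, m) and (b, c, c^j), where
    ba = bc = 0. *)
Definition gamma_b_mono (i j : nat) : Q :=
  match i, j with
  | i'.+1, _ =>
    f xb xa (xa ^+ i' * xc ^+ j) + G_ba * (xa ^+ i' * xc ^+ j)
  | 0, j'.+1 => f xb xc (xc ^+ j') + G_bc * xc ^+ j'
  | 0, 0 => 0
  end.

Lemma deg_gamma (gam : Q -> Q) : linear gam ->
  (forall i j, deg_ab_bc (i + j)%N (gam (xa ^+ i * xc ^+ j))) ->
  (forall k, deg_ab_bc k.+1 (gam (xb ^+ k.+1))) ->
  forall d x, deg_ab_bc d x -> deg_ab_bc d (gam x).
Proof.
move=> gl gac gb d x dx; rewrite -[d]add0r; apply: deg_linear dx => // [i j|k];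
by rewrite add0r.
Qed.

Let fdeg d e k x y z D : deg_ab_bc d x -> deg_ab_bc e y -> deg_ab_bc k z ->
  D = d + e + k - 1 -> deg_ab_bc D (f x y z).
Proof. by move=> dx dy dz ->; apply: tri_deg fc _ _ _ _ _ _ dx dy dz. Qed.

Let degM d e x y D : deg_ab_bc d x -> deg_ab_bc e y -> D = d + e ->
  deg_ab_bc D (x * y).
Proof. by move=> dx dy ->; apply: deg_ab_bcM. Qed.

(** This will be g(a, .): it may be chosen as 0 on the words a^i c^j, and vanishing at (a, b, b^k)
    forces it on powers of b. *)
Lemma exists_gamma_a : exists gam : {linear Q -> Q},
  [/\ forall d x, deg_ab_bc d x -> deg_ab_bc d (gam x),
    forall i j, gam (xa ^+ i * xc ^+ j) = 0 &
    forall k, gam (xb ^+ k.+1) = f xa xb (xb ^+ k) + G_ab * xb ^+ k].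
Proof.
have [gam [gac gb]] := Q_linear_extension Q (fun _ _ => 0)
  (fun k => f xa xb (xb ^+ k) + G_ab * xb ^+ k).
exists gam; split=> // d x; apply: deg_gamma => //; first exact: linearP.
  by move=> i j; rewrite gac; apply: deg0.
move=> k; rewrite gb; apply: degD.
  by apply: fdeg deg_xa deg_xb (deg_mono_b k) _; lia.
by apply: degM dG_ab (deg_mono_b k) _; lia.
Qed.

Lemma exists_gamma_b : exists gam : {linear Q -> Q},
  [/\ forall d x, deg_ab_bc d x -> deg_ab_bc d (gam x),
    forall i j, gam (xa ^+ i * xc ^+ j) = gamma_b_mono i j &
    forall k, gam (xb ^+ k) = 0].
Proof.
have [gam [gac gb]] := Q_linear_extension Q gamma_b_mono (fun=> 0).
exists gam; split=> // [d x|[|k] //]; last by have := gac 0 0; rewrite mulr1.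
apply: deg_gamma => //; first exact: linearP.
  case=> [|i] [|j]; rewrite gac [gamma_b_mono _ _]/=; first exact: deg0.
  - apply: degD; last by apply: degM dG_bc (degX j _ deg_xc) _; lia.
    by apply: fdeg deg_xb deg_xc (degX j _ deg_xc) _; lia.
  - apply: degD; last by apply: degM dG_ba (deg_mono_ac i 0) _; lia.
    by apply: fdeg deg_xb deg_xa (deg_mono_ac i 0) _; lia.
  - apply: degD; last by apply: degM dG_ba (deg_mono_ac i j.+1) _; lia.
    by apply: fdeg deg_xb deg_xa (deg_mono_ac i j.+1) _; lia.
by move=> k; rewrite gb; apply: deg0.
Qed.

Lemma exists_gamma_c : exists gam : {linear Q -> Q},
  [/\ forall d x, deg_ab_bc d x -> deg_ab_bc d (gam x),
    forall i j, gam (xa ^+ i * xc ^+ j) = gamma_c_mono i j &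
    forall k, gam (xb ^+ k.+1) = f xc xb (xb ^+ k) + G_cb * xb ^+ k].
Proof.
have [gam [gac gb]] := Q_linear_extension Q gamma_c_mono
  (fun k => f xc xb (xb ^+ k) + G_cb * xb ^+ k).
exists gam; split=> // d x; apply: deg_gamma => //; first exact: linearP.
  move=> i j; rewrite gac; elim: i => [|i IH]; [exact: deg0|rewrite [gamma_c_mono _ _]/=].
  have dm := deg_mono_ac i j.
  apply: degD; last by apply: degM dG_ca dm _; lia.
  apply: degD; last by apply: degM deg_xa IH _; lia.
  apply: degD; last by apply: fdeg deg_xa deg_xc dm _; lia.
  by apply: fdeg deg_xc deg_xa dm _; lia.
move=> k; rewrite gb; apply: degD.
  by apply: fdeg deg_xc deg_xb (deg_mono_b k) _; lia.
by apply: degM dG_cb (deg_mono_b k) _; lia.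
Qed.

(* The value g(v m, y) forced by the vanishing of (f + dbar2 g)(v, m, y), where
   [gam] is g(v, .) and [h] is g(m, .). *)
Definition g_step (v m : Q) (gam : Q -> Q) (h : Q -> Q) (y : Q) : Q :=
  v * h y + gam (m * y) + gam m * y + f v m y.

(** The first argument is handled by recursion on its first letter, starting from g(1, .) = 0. A
    word a^i c^j loses its letters a first, then its letters c. *)
Lemma exists_bilinear (gam_a gam_b gam_c : {linear Q -> Q}) :
  (forall d x, deg_ab_bc d x -> deg_ab_bc d (gam_a x)) ->
  (forall d x, deg_ab_bc d x -> deg_ab_bc d (gam_b x)) ->
  (forall d x, deg_ab_bc d x -> deg_ab_bc d (gam_c x)) ->
  exists g, [/\ bicochain g, forall y, g 1 y = 0,
    forall i j y, g (xa * (xa ^+ i * xc ^+ j)) y =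
      g_step xa (xa ^+ i * xc ^+ j) gam_a (g (xa ^+ i * xc ^+ j)) y,
    forall k y, g (xb * xb ^+ k) y = g_step xb (xb ^+ k) gam_b (g (xb ^+ k)) y &
    forall j y, g (xc * xc ^+ j) y = g_step xc (xc ^+ j) gam_c (g (xc ^+ j)) y].
Proof.
move=> da db dc.
pose gb := fix gb k : Q -> Q :=
  if k is k'.+1 then g_step xb (xb ^+ k') gam_b (gb k') else 0.
pose gc := fix gc j : Q -> Q :=
  if j is j'.+1 then g_step xc (xc ^+ j') gam_c (gc j') else 0.
pose gac := fix gac i j : Q -> Q :=
  if i is i'.+1 then g_step xa (xa ^+ i' * xc ^+ j) gam_a (gac i' j) else gc j.
(* With functions as values, linearity in the first argument is automatic; linearity in the second
   is checked on words. *)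
have [g [Eac Eb]] := Q_linear_extension (Q -> Q) gac (fun k => gb k.+1).
have Eb' k : g (xb ^+ k) = gb k.
  by case: k => //; have := Eac 0 0; rewrite mulr1.
have Ec j : g (xc ^+ j) = gc j by have := Eac 0 j; rewrite mul1r.
have step_lin v m (gam : {linear Q -> Q}) h : linear h ->
    linear (g_step v m gam h).
  move=> hl; apply: linear_add; [apply: linear_add; [apply: linear_add|]|].
  - exact: linear_mull.
  - by move=> k y z; rewrite mulrDr -scalerAr linearP.
  - exact: linear_mull.
  - exact: tri_lin3.
have step_deg v m (gam : {linear Q -> Q}) h (n : nat) :
    (forall d x, deg_ab_bc d x -> deg_ab_bc d (gam x)) ->
    deg_ab_bc 1%N v -> deg_ab_bc n m ->
    (forall e y, deg_ab_bc e y -> deg_ab_bc (n%:Z + e - 1) (h y)) ->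
    forall e y, deg_ab_bc e y -> deg_ab_bc (n.+1%:Z + e - 1) (g_step v m gam h y).
  move=> dgam dv dm dh e y dy; rewrite /g_step.
  apply: degD; last by apply: fdeg dv dm dy _; lia.
  apply: degD; last by apply: degM (dgam _ _ dm) dy _; lia.
  apply: degD; first by apply: degM dv (dh _ _ dy) _; lia.
  by apply: dgam; apply: degM dm dy _; lia.
have lin0 : linear (0 : Q -> Q) by move=> k x y; rewrite /= scaler0 addr0.
have gb_lin k : linear (gb k) by elim: k => //= k IH; apply: step_lin.
have gc_lin j : linear (gc j) by elim: j => //= j IH; apply: step_lin.
have gac_lin i j : linear (gac i j) by elim: i => //= i IH; apply: step_lin.
have gb_deg k e y : deg_ab_bc e y -> deg_ab_bc (k%:Z + e - 1) (gb k y).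
  elim: k e y => [|k IH] e y; first by move=> _; apply: deg0.
  by apply: step_deg => //; [exact: deg_xb|exact: deg_mono_b].
have gc_deg j e y : deg_ab_bc e y -> deg_ab_bc (j%:Z + e - 1) (gc j y).
  elim: j e y => [|j IH] e y; first by move=> _; apply: deg0.
  by apply: step_deg => //; [exact: deg_xc|apply: degX deg_xc].
have gac_deg i j e y : deg_ab_bc e y ->
    deg_ab_bc ((i + j)%N%:Z + e - 1) (gac i j y).
  elim: i e y => [|i IH] e y; first exact: gc_deg.
  by apply: step_deg => //; [exact: deg_xa|exact: deg_mono_ac].
exists (fun x y => g x y); split.
- split=> [y k x x'|x|d e x y dx dy]; first by rewrite linearP fctE.
    elim/mono_ind: x => [|k x x' gx gx'|i j|k].
    + by rewrite raddf0.
    + by move=> l y y'; rewrite linearP !fctE gx gx' !scalerDr !scalerA mulrC addrACA.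
    + by rewrite Eac.
    + by rewrite Eb.
  apply: (deg_eq (e - 1 + d)); first lia.
  apply: (deg_linear (fun x => g x y)) dx.
  + by move=> k x1 x2; rewrite linearP fctE.
  + by move=> i j; rewrite Eac; apply: deg_eq (gac_deg i j e y dy); lia.
  + by move=> k; rewrite Eb; apply: deg_eq (gb_deg k.+1 e y dy); lia.
- by move=> y; have := Eac 0 0; rewrite mulr1 => ->.
- by move=> i j y; rewrite mulrA -exprS !Eac.
- by move=> k y; rewrite -exprS Eb Eb'.
- by move=> j y; rewrite -exprS !Ec.
Qed.

(** Vanishing at (v, m, z) is built into [g_step], vanishing at (v1, v2, m) into the gamma maps. The
    values on ab, cb, ba, bc, ca remain free: zeros serve to reduce a given cocycle, and f = 0
    yields a reduced coboundary with adjustable values. *)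
Lemma exists_reducing : exists2 g, bicochain g &
  [/\ reduced (fun x y z => f x y z + dbar2 g x y z),
      [/\ g xa xb = G_ab, g xc xb = G_cb & g xb xa = G_ba] &
      [/\ g xb xc = G_bc, g xc xa = G_ca & g xa xc = 0]].
Proof.
have [gam_a [da gaac gab]] := exists_gamma_a.
have [gam_b [db gbac gbb]] := exists_gamma_b.
have [gam_c [dc gcac gcb]] := exists_gamma_c.
have [g [gc g1 ga gb gcc]] := exists_bilinear _ _ _ da db dc.
have gam_a1 : gam_a 1 = 0 by have := gaac 0 0; rewrite mulr1.
have gam_c_c j : gam_c (xc ^+ j) = 0 by have := gcac 0 j; rewrite mul1r.
have g_a y : g xa y = gam_a y.
  have := ga 0 0 y; rewrite /g_step !mulr1 mul1r f2 g1 gam_a1.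
  by rewrite mulr0 mul0r add0r !addr0.
have g_b y : g xb y = gam_b y.
  have := gb 0 y; rewrite /g_step !mulr1 mul1r f2 g1 (gbb 0).
  by rewrite mulr0 mul0r add0r !addr0.
have g_c y : g xc y = gam_c y.
  have := gcc 0 y; rewrite /g_step !mulr1 mul1r f2 g1 (gam_c_c 0).
  by rewrite mulr0 mul0r add0r !addr0.
have g0 y : g 0 y = 0 by apply: (linear_at0 (g^~ y)) (bi_linl _ gc y).
have g_ac : g xa xc = 0 by rewrite g_a; have := gaac 0 1; rewrite mul1r.
have gam_b_c : gam_b xc = G_bc.
  by have := gbac 0 1; rewrite /= !expr0 mul1r f3 add0r mulr1.
have gam_b_a : gam_b xa = G_ba.
  by have := gbac 1 0; rewrite /= !expr0 !mulr1 f3 add0r.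
have gam_c_a : gam_c xa = G_ca.
  by have := gcac 1 0; rewrite /= !expr0 !mulr1 !f3 mulr0 !add0r.
have gam_a_b : gam_a xb = G_ab.
  by have := gab 0; rewrite !expr0 f3 mulr1 add0r.
have gam_c_b : gam_c xb = G_cb.
  by have := gcb 0; rewrite !expr0 f3 mulr1 add0r.
exists g => //; split; [|by rewrite g_a g_b g_c|by rewrite g_b g_c].
have cancel (u v : Q) : v = u -> u + v = 0 by move=> ->; ring2.
split=> [y z|i j z|k z|j z|k|k|i j|j|i j].
- by rewrite f1 /dbar2 !g1 !mul1r mul0r; ring2.
- rewrite /dbar2 ga /g_step !g_a; ring2.
- rewrite /dbar2 gb /g_step !g_b; ring2.
- rewrite /dbar2 gcc /g_step !g_c; ring2.
- apply: cancel; rewrite /dbar2 mul_ab g0 !g_a g_b gbb -exprS gab gam_a_b.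
  ring2.
- apply: cancel; rewrite /dbar2 (mulrC xc xb) mul_bc g0 !g_c g_b gbb -exprS gcb.
  rewrite gam_c_b; ring2.
- apply: cancel; rewrite /dbar2 (mulrC xb xa) mul_ab g0 !g_b g_a gaac mulrA -exprS.
  rewrite gbac /= gam_b_a; ring2.
- apply: cancel; rewrite /dbar2 mul_bc g0 !g_b g_c gam_c_c -exprS gam_b_c.
  have := gbac 0 j.+1; rewrite mul1r /= => ->.
  ring2.
(* The term g(ca, m) is expanded through the normal word ac. *)
- apply: cancel; rewrite /dbar2 (mulrC xc xa).
  have := ga 0 1; rewrite mul1r => ->.
  rewrite /g_step !g_c !g_a gaac (mulrA xa) -exprS gcac.
  have := gaac 0 1; rewrite mul1r => ->.
  rewrite (_ : xc * (xa ^+ i * xc ^+ j) = xa ^+ i * xc ^+ j.+1); last first.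
    by rewrite exprS; ring.
  rewrite gaac !gcac gam_c_a [gamma_c_mono i.+1 j]/= expr1.
  ring2.
Qed.

End Reducing.

(** * Reduced cocycles and their values on the eight words *)

Lemma linear_eq0 (h : Q -> Q) : linear h ->
  (forall i j, h (xa ^+ i * xc ^+ j) = 0) -> (forall k, h (xb ^+ k.+1) = 0) ->
  forall x, h x = 0.
Proof.
move=> hl hac hb; apply: mono_ind => // [|k x y hx hy].
  exact: linear_at0.
by rewrite hl hx hy scaler0 addr0.
Qed.

Section ReducedCocycle.
Variable f : Q -> Q -> Q -> Q.
Hypotheses (fc : tricochain f) (df : forall x y z t, dbar3 f x y z t = 0).
Hypothesis fr : reduced f.

Let D1 x y z t : f (x * y) z t
  = x * f y z t + f x (y * z) t + f x y (z * t) + f x y z * t.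
Proof. by have [] := dbar3_eq0 _ _ _ _ _ (df x y z t). Qed.

Let D2 x y z t : f x (y * z) t
  = x * f y z t + f (x * y) z t + f x y (z * t) + f x y z * t.
Proof. by have [] := dbar3_eq0 _ _ _ _ _ (df x y z t). Qed.

Let D3 x y z t : f x y (z * t)
  = x * f y z t + f (x * y) z t + f x (y * z) t + f x y z * t.
Proof. by have [] := dbar3_eq0 _ _ _ _ _ (df x y z t). Qed.

Let f0l y z : f 0 y z = 0.
Proof. exact: (linear_at0 (fun x => f x y z)) (tri_lin1 _ fc y z). Qed.
Let f0m x z : f x 0 z = 0.
Proof. exact: (linear_at0 (fun y => f x y z)) (tri_lin2 _ fc x z). Qed.

Let ba0 : xb * xa = 0 :> Q. Proof. by rewrite mulrC mul_ab. Qed.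
Let cb0 : xc * xb = 0 :> Q. Proof. by rewrite mulrC mul_bc. Qed.

Let c_mono i j : xc * (xa ^+ i * xc ^+ j) = xa ^+ i * xc ^+ j.+1 :> Q.
Proof. by rewrite exprS; ring. Qed.

Let f_ac z : f xa xc z = 0.
Proof. by have := red_a _ fr 0 1 z; rewrite mul1r. Qed.

Let f_bac : f xb xa xc = 0.
Proof. by have := red_ba _ fr 0 1; rewrite mul1r. Qed.

Let f_ac_mono i j z :
  f (xa * xc) (xa ^+ i * xc ^+ j) z = xa * f xc (xa ^+ i * xc ^+ j) z.
Proof.
by rewrite D1 c_mono (red_a _ fr) !f_ac mul0r !addr0.
Qed.

(* On a reduced cocycle, f(v1, v2, v3 m) = f(v1, v2, v3) m whenever v1 v2 and
   v2 v3 are not normal and v3 m is. *)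
Let f_chain u v w m : f v w m = 0 -> f (u * v) w m = 0 -> f u (v * w) m = 0 ->
  f u v (w * m) = f u v w * m.
Proof. by move=> h1 h2 h3; rewrite D3 h1 h2 h3 mulr0 !add0r. Qed.

Lemma red_aba i j :
  f xa xb (xa * (xa ^+ i * xc ^+ j)) = f xa xb xa * (xa ^+ i * xc ^+ j).
Proof. by apply: f_chain; rewrite ?mul_ab ?ba0 ?(red_ba _ fr). Qed.

Lemma red_abc j : f xa xb (xc * xc ^+ j) = f xa xb xc * xc ^+ j.
Proof. by apply: f_chain; rewrite ?mul_ab ?mul_bc ?(red_bc _ fr). Qed.

Lemma red_cba i j :
  f xc xb (xa * (xa ^+ i * xc ^+ j)) = f xc xb xa * (xa ^+ i * xc ^+ j).
Proof. by apply: f_chain; rewrite ?cb0 ?ba0 ?(red_ba _ fr). Qed.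

Lemma red_cbc j : f xc xb (xc * xc ^+ j) = f xc xb xc * xc ^+ j.
Proof. by apply: f_chain; rewrite ?cb0 ?mul_bc ?(red_bc _ fr). Qed.

Lemma red_bab k : f xb xa (xb * xb ^+ k) = f xb xa xb * xb ^+ k.
Proof. by apply: f_chain; rewrite ?ba0 ?mul_ab ?(red_ab _ fr). Qed.

Lemma red_bcb k : f xb xc (xb * xb ^+ k) = f xb xc xb * xb ^+ k.
Proof. by apply: f_chain; rewrite ?mul_bc ?cb0 ?(red_cb _ fr). Qed.

Lemma red_bca i j :
  f xb xc (xa * (xa ^+ i * xc ^+ j)) = f xb xc xa * (xa ^+ i * xc ^+ j).
Proof.
(* The remaining condition f(b, ca, m) = 0 follows from ca = ac and the cocycle identity at (b, a,
   c, m). *)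
apply: f_chain; rewrite ?mul_bc ?(red_ca _ fr) // (mulrC xc) D2.
by rewrite !f_ac ba0 f0l c_mono (red_ba _ fr) f_bac mulr0 mul0r !addr0.
Qed.

Lemma red_cab k : f xc xa (xb * xb ^+ k) = f xc xa xb * xb ^+ k.
Proof.
(* Here f(ca, b, b^k) = 0 comes from the identity at (a, c, b, b^k). *)
apply: f_chain; rewrite ?mul_ab ?(red_ab _ fr) // (mulrC xc) D1 cb0.
by rewrite (red_cb _ fr) f0m !f_ac mul0r mulr0 !addr0.
Qed.

(** The chain identities give f(v1, v2, .) = 0 for the five non-normal pairs of letters. Peeling
    letters off the second argument, then off the first, extends this to all words. *)
Lemma reduced_eq0 :
  [/\ f xa xb xa = 0, f xa xb xc = 0, f xc xb xa = 0 & f xc xb xc = 0] ->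
  [/\ f xb xa xb = 0, f xb xc xb = 0, f xb xc xa = 0 & f xc xa xb = 0] ->
  forall x y z, f x y z = 0.
Proof.
move=> [aba abc cba cbc] [bab bcb bca cab].
have E u v (z : Q) : (forall i j, f u v (xa * (xa ^+ i * xc ^+ j)) = 0) ->
    (forall j, f u v (xc ^+ j) = 0) -> (forall k, f u v (xb ^+ k.+1) = 0) ->
    f u v z = 0.
  move=> ha hc hb; move: z; apply: linear_eq0 => //; first exact: tri_lin3 fc u v.
  by case=> [|i] j; [rewrite mul1r|rewrite exprS -mulrA].
have f_ab z : f xa xb z = 0.
  apply: E => [i j|[|j]|k]; last exact: red_ab.
  - by rewrite red_aba aba mul0r.
  - exact: (red_ab _ fr 0).
  - by rewrite exprS red_abc abc mul0r.
have f_cb z : f xc xb z = 0.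
  apply: E => [i j|[|j]|k]; last exact: red_cb.
  - by rewrite red_cba cba mul0r.
  - exact: (red_cb _ fr 0).
  - by rewrite exprS red_cbc cbc mul0r.
have f_ba z : f xb xa z = 0.
  apply: E => [i j|j|k].
  - by rewrite mulrA -exprS (red_ba _ fr).
  - by have := red_ba _ fr 0 j; rewrite mul1r.
  - by rewrite exprS red_bab bab mul0r.
have f_bc z : f xb xc z = 0.
  apply: E => [i j|j|k]; last by rewrite exprS red_bcb bcb mul0r.
  - by rewrite red_bca bca mul0r.
  - exact: red_bc.
have f_ca z : f xc xa z = 0.
  apply: E => [i j|j|k]; last by rewrite exprS red_cab cab mul0r.
  - by rewrite mulrA -exprS (red_ca _ fr).
  - by have := red_ca _ fr 0 j; rewrite mul1r.
have f_a y z : f xa y z = 0.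
  move: y; apply: linear_eq0 => [|i j|k]; [exact: tri_lin2 fc _ z|exact: red_a|].
  by rewrite exprS D2 !f_ab (red_b _ fr) mul_ab f0l mul0r mulr0 !addr0.
have f_b y z : f xb y z = 0.
  move: y; apply: linear_eq0 => [|i j|k]; [exact: tri_lin2 fc _ z| |exact: red_b].
  case: i => [|i]; first case: j => [|j].
  - by rewrite mul1r; apply: (red_b _ fr 0).
  - by rewrite mul1r exprS D2 !f_bc (red_c _ fr) mul_bc f0l mul0r mulr0 !addr0.
  - by rewrite exprS -mulrA D2 !f_ba f_a ba0 f0l mul0r mulr0 !addr0.
have f_c y z : f xc y z = 0.
  move: y; apply: linear_eq0 => [|i j|k]; [exact: tri_lin2 fc _ z| |].
    (* Moving c past a produces f(ac, m, z) = a f(c, m, z), whence the induction on i. *)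
    elim: i => [|i IH]; first by rewrite mul1r (red_c _ fr).
    rewrite exprS -mulrA D2 !f_ca f_a (mulrC xc xa) f_ac_mono IH.
    by rewrite mul0r !mulr0 !addr0.
  by rewrite exprS D2 !f_cb (red_b _ fr) cb0 f0l mul0r mulr0 !addr0.
move=> x y z; move: x y z.
have step v m : (forall y z, f v y z = 0) -> (forall y z, f m y z = 0) ->
    forall y z, f (v * m) y z = 0.
  by move=> hv hm y z; rewrite D1 !hv hm mul0r mulr0 !addr0.
have f_X v n : (forall y z, f v y z = 0) -> forall y z, f (v ^+ n) y z = 0.
  move=> hv; elim: n => [|n IH]; first exact: red_1.
  by rewrite exprS; apply: step.
move=> x y z; move: x; apply: linear_eq0 => [|i j|k]; last exact: f_X.
  exact: tri_lin1 fc y z.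
elim: i y z => [|i IH] y z; first by rewrite mul1r f_X.
by rewrite exprS -mulrA step.
Qed.

(* The cocycle conditions on the words of length four all of whose two-letter
   factors are among ab, ba, bc, cb, ca; the words baba, babc, bcba, bcbc are
   omitted as they give nothing new. *)
Lemma reduced_relations :
  [/\ xa * f xb xa xb + f xa xb xa * xb = 0,
      xa * f xb xc xb + f xa xb xc * xb = 0,
      xc * f xb xa xb + f xc xb xa * xb = 0,
      xc * f xb xc xb + f xc xb xc * xb = 0 &
      xb * f xc xa xb + f xb xc xa * xb = 0] /\
  [/\ xa * f xb xc xa + f xa xb xc * xa = f xa xb xa * xc,
      xc * f xb xc xa + f xc xb xc * xa = f xc xb xa * xc,
      xc * f xa xb xa + f xc xa xb * xa = xa * f xc xb xa &
      xc * f xa xb xc + f xc xa xb * xc = xa * f xc xb xc].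
Proof.
have D x y z t : x * f y z t + f x y z * t
    = f (x * y) z t + f x (y * z) t + f x y (z * t).
  by rewrite D1; ring2.
(* This is the source of the right-hand sides of the last two relations. *)
have f_ca_b z : f (xc * xa) xb z = xa * f xc xb z.
  by rewrite mulrC D1 cb0 f0m !f_ac mul0r !addr0.
have f0r x y : f x y 0 = 0 by apply: linear_at0 (tri_lin3 _ fc x y).
split; split.
- by rewrite D mul_ab ba0 f0l f0m f0r !addr0.
- by rewrite D mul_ab mul_bc cb0 f0l f0m f0r !addr0.
- by rewrite D mul_ab ba0 cb0 f0l f0m f0r !addr0.
- by rewrite D mul_bc cb0 f0l f0m f0r !addr0.
- rewrite D mul_bc mul_ab f0l f0r add0r addr0 (mulrC xc) D2.
  by rewrite f_ac ba0 cb0 f_bac f0l f0r mul0r mulr0 !addr0.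
(* The surviving term is f(a, b, ca) = f(a, b, ac) = f(a, b, a) c. *)
- rewrite D mul_ab mul_bc f0l f0m !add0r (mulrC xc).
  by have := red_aba 0 1; rewrite mul1r.
- rewrite D cb0 mul_bc f0l f0m !add0r (mulrC xc xa).
  by have := red_cba 0 1; rewrite mul1r.
- by rewrite D f_ca_b mul_ab ba0 f0m f0r !addr0.
- by rewrite D f_ca_b mul_ab mul_bc f0m f0r !addr0.
Qed.

End ReducedCocycle.

(** * Linear, quadratic and cubic forms and their coefficients *)

Definition lin (p q r : Q) : Q := p * xa + q * xc + r * xb.

(** Coefficients live in the algebra so that [ring] can treat them; scalars of F_2 enter through
    [sc]. *)
HB.lock Definition quad (p q r s : Q) : Q :=
  p * xa ^+ 2 + q * (xa * xc) + r * xc ^+ 2 + s * xb ^+ 2.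

HB.lock Definition cub (p q r s t : Q) : Q :=
  p * xa ^+ 3 + q * (xa ^+ 2 * xc) + r * (xa * xc ^+ 2) + s * xc ^+ 3
  + t * xb ^+ 3.

Lemma mul_a_quad p q r s : xa * quad p q r s = cub p q r 0 0.
Proof. rewrite quad.unlock cub.unlock; ring: mul_ab. Qed.

Lemma mul_b_quad p q r s : xb * quad p q r s = cub 0 0 0 0 s.
Proof. rewrite quad.unlock cub.unlock; ring: mul_ab mul_bc. Qed.

Lemma mul_c_quad p q r s : xc * quad p q r s = cub 0 p q r 0.
Proof. rewrite quad.unlock cub.unlock; ring: mul_bc. Qed.

Lemma cubD p q r s t p' q' r' s' t' :
  cub p q r s t + cub p' q' r' s' t'
  = cub (p + p') (q + q') (r + r') (s + s') (t + t').
Proof. rewrite cub.unlock; ring. Qed.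

Lemma quadP k p q r s p' q' r' s' :
  k * quad p q r s + quad p' q' r' s'
  = quad (k * p + p') (k * q + q') (k * r + r') (k * s + s').
Proof. rewrite quad.unlock; ring. Qed.

Lemma cub0 : cub 0 0 0 0 0 = 0.
Proof. by rewrite cub.unlock !mul0r !addr0. Qed.

HB.lock Definition sc (k : 'F_2) : Q := k%:A.

Lemma sc0 : sc 0 = 0. Proof. by rewrite sc.unlock scale0r. Qed.

Lemma sc1 : sc 1 = 1. Proof. by rewrite sc.unlock scale1r. Qed.

Lemma scD k l : sc (k + l) = sc k + sc l. Proof. by rewrite sc.unlock scalerDl. Qed.

Lemma scM k l : sc (k * l) = sc k * sc l.
Proof. by rewrite sc.unlock -scalerA mulr_algl. Qed.

Lemma sc_mul k x : sc k * x = k *: x. Proof. by rewrite sc.unlock mulr_algl. Qed.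

Lemma deg2_quad (x : Q) : deg_ab_bc 2%N x ->
  exists p q r s : 'F_2, x = quad (sc p) (sc q) (sc r) (sc s).
Proof.
move: x; apply: mono_ind_deg.
- by exists 0, 0, 0, 0; rewrite quad.unlock !sc0 !mul0r !addr0.
- move=> k x y [p [q [r [s ->]]]] [p' [q' [r' [s' ->]]]].
  exists (k * p + p'), (k * q + q'), (k * r + r'), (k * s + s').
  by rewrite -sc_mul quadP !scD !scM.
- case=> [|[|[|//]]] [|[|[|//]]] // _; rewrite quad.unlock.
  + by exists 0, 0, 1, 0; rewrite !sc0 sc1 !mul0r !mul1r !(add0r, addr0).
  + by exists 0, 1, 0, 0; rewrite !sc0 sc1 !mul0r !mul1r !(add0r, addr0).
  + exists 1, 0, 0, 0; rewrite !sc0 sc1 !mul0r !mul1r !(add0r, addr0).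
    by rewrite mulr1.
- case=> [|[|]] // _; exists 0, 0, 0, 1; rewrite quad.unlock.
  by rewrite !sc0 sc1 !mul0r !mul1r !(add0r, addr0).
Qed.

Lemma cub_eq0 (p q r s t : 'F_2) : cub (sc p) (sc q) (sc r) (sc s) (sc t) = 0 ->
  [/\ p = 0, q = 0, r = 0, s = 0 & t = 0].
Proof.
(* Coordinate j < 4 reads the coefficient of a^(3-j) c^j, coordinate 4 that of b^3. *)
have [L [Lac Lb]] := Q_linear_extension (nat -> GRing.regular 'F_2)
  (fun i j n => ((i + j == 3) && (j == n))%N%:R) (fun k n => (n == 4)%N%:R).
have LZ k m : L (sc k * m) = k *: L m by rewrite sc_mul linearZ.
have L30 : L (xa ^+ 3) = _ := etrans (congr1 L (esym (mulr1 _))) (Lac 3 0).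
have L03 : L (xc ^+ 3) = _ := etrans (congr1 L (esym (mul1r _))) (Lac 0 3).
have L21 : L (xa ^+ 2 * xc) = _ := Lac 2 1.
have L12 : L (xa * xc ^+ 2) = _ := Lac 1 2.
move=> /(congr1 L); rewrite cub.unlock raddf0 !raddfD /= !LZ L30 L21 L12 L03 Lb => H.
by split; [have := congr1 (@^~ 0%N) H|have := congr1 (@^~ 1%N) H|
  have := congr1 (@^~ 2%N) H|have := congr1 (@^~ 3%N) H|
  have := congr1 (@^~ 4%N) H];
  rewrite !fctE /= !scaler0 ?(add0r, addr0) /GRing.scale /= mulr1.
Qed.

Lemma cubD_inj (p q r s t p' q' r' s' t' p'' q'' r'' s'' t'' : 'F_2) :
  cub (sc p) (sc q) (sc r) (sc s) (sc t)
    + cub (sc p') (sc q') (sc r') (sc s') (sc t')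
    = cub (sc p'') (sc q'') (sc r'') (sc s'') (sc t'') ->
  [/\ p + p' = p'', q + q' = q'', r + r' = r'', s + s' = s'' & t + t' = t''].
Proof.
move=> H.
have addxx (u : Q) : u + u = 0 by ring2.
have eqF2 (u v w : 'F_2) : u + v + w = 0 -> u + v = w.
  by move=> /eqP; rewrite addr_eq0 => /eqP->; case: w => [[|[|]]] // ?; apply/val_inj.
have [] := cub_eq0 (p + p' + p'') (q + q' + q'') (r + r' + r'') (s + s' + s'')
  (t + t' + t'').
  by rewrite !scD -!cubD H addxx.
by do 5 ![move=> /eqF2->].
Qed.

Notation quadF p q r s := (quad (sc p) (sc q) (sc r) (sc s)).

(** In this and the following lemmas a cubic relation is split into coefficients: b keeps only the
    b^2 term, while a and c kill it and shift the words in a and c. The names list the multiplying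
    letters. *)
Lemma rel_a_b p q r s p' q' r' s' :
  xa * quadF p q r s + quadF p' q' r' s' * xb = 0 ->
  [/\ p = 0, q = 0, r = 0 & s' = 0].
Proof.
rewrite (mulrC (quadF p' q' r' s')) mul_a_quad mul_b_quad -[X in _ = X -> _]cub0 -sc0.
by move=> /cubD_inj[]; rewrite !(add0r, addr0).
Qed.

Lemma rel_c_b p q r s p' q' r' s' :
  xc * quadF p q r s + quadF p' q' r' s' * xb = 0 ->
  [/\ p = 0, q = 0, r = 0 & s' = 0].
Proof.
rewrite (mulrC (quadF p' q' r' s')) mul_c_quad mul_b_quad -[X in _ = X -> _]cub0 -sc0.
by move=> /cubD_inj[]; rewrite !(add0r, addr0).
Qed.

Lemma rel_b_b p q r s p' q' r' s' :
  xb * quadF p q r s + quadF p' q' r' s' * xb = 0 -> s + s' = 0.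
Proof.
rewrite (mulrC (quadF p' q' r' s')) 2!mul_b_quad -[X in _ = X -> _]cub0 -sc0.
by move=> /cubD_inj[].
Qed.

Lemma rel_aac p q r s p' q' r' s' p'' q'' r'' s'' :
  xa * quadF p q r s + quadF p' q' r' s' * xa = quadF p'' q'' r'' s'' * xc ->
  [/\ p + p' = 0, q + q' = p'', r + r' = q'' & r'' = 0].
Proof.
rewrite (mulrC (quadF p' q' r' s')) (mulrC (quadF p'' q'' r'' s'')).
rewrite 2!mul_a_quad mul_c_quad -sc0.
by move=> /cubD_inj[]; rewrite !(add0r, addr0).
Qed.

Lemma rel_caa p q r s p' q' r' s' p'' q'' r'' s'' :
  xc * quadF p q r s + quadF p' q' r' s' * xa = xa * quadF p'' q'' r'' s'' ->
  [/\ p' = p'', p + q' = q'', q + r' = r'' & r = 0].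
Proof.
rewrite (mulrC (quadF p' q' r' s')) 2!mul_a_quad mul_c_quad -sc0.
by move=> /cubD_inj[]; rewrite !(add0r, addr0).
Qed.

Lemma rel_cac p q r s p' q' r' s' p'' q'' r'' s'' :
  xc * quadF p q r s + quadF p' q' r' s' * xa = quadF p'' q'' r'' s'' * xc ->
  [/\ p' = 0, p + q' = p'', q + r' = q'' & r = r''].
Proof.
rewrite (mulrC (quadF p' q' r' s')) (mulrC (quadF p'' q'' r'' s'')).
rewrite mul_a_quad 2!mul_c_quad -sc0.
by move=> /cubD_inj[]; rewrite !(add0r, addr0).
Qed.

Lemma rel_cca p q r s p' q' r' s' p'' q'' r'' s'' :
  xc * quadF p q r s + quadF p' q' r' s' * xc = xa * quadF p'' q'' r'' s'' ->
  [/\ p'' = 0, p + p' = q'', q + q' = r'' & r + r' = 0].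
Proof.
rewrite (mulrC (quadF p' q' r' s')) mul_a_quad 2!mul_c_quad -sc0.
by move=> /cubD_inj[]; rewrite !(add0r, addr0).
Qed.

(** * Solving the linear system *)

Lemma deg_lin p q r : deg_ab_bc 1%N (lin (sc p) (sc q) (sc r)).
Proof.
rewrite /lin !sc_mul -[r *: xb]addr0 -addrA.
exact: degP deg_xa (degP _ _ _ _ deg_xc (degP _ _ _ _ deg_xb (deg0 _))).
Qed.

Lemma reducedD f f' : reduced f -> reduced f' ->
  reduced (fun x y z => f x y z + f' x y z).
Proof.
move=> [f1 fa fb fcc fab fcb fba fbc fca] [f1' fa' fb' fc' fab' fcb' fba' fbc' fca'].
by split=> *; rewrite (f1, fa, fb, fcc, fab, fcb, fba, fbc, fca)
  (f1', fa', fb', fc', fab', fcb', fba', fbc', fca') addr0.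
Qed.

(** Three corrections are added in turn: [g0] normalizes, [g1] reduces, and [g2] clears the eight
    remaining values, after which [reduced_eq0] applies. *)
Lemma tricocycle_dbar2 f : tricochain f -> (forall x y z t, dbar3 f x y z t = 0) ->
  exists2 g, bicochain g & forall x y z, f x y z = dbar2 g x y z.
Proof.
move=> fc df.
have [g0 g0c f1n] := exists_normalizing f fc df.
set f1 := (fun x y z => _) in f1n.
have f1c : tricochain f1 by apply: tricochainD => //; apply: tricochain_dbar2.
have df1 x y z t : dbar3 f1 x y z t = 0.
  by rewrite /f1 dbar3D df dbar3_dbar2 // addr0.
have d10 : deg_ab_bc 1%N 0 by apply: deg0.
have [g1 g1c [f2r _ _]] := exists_reducing f1 0 0 0 0 0 f1c f1n d10 d10 d10 d10 d10.
set f2 := (fun x y z => _) in f2r.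
have f2c : tricochain f2 by apply: tricochainD => //; apply: tricochain_dbar2.
have df2 x y z t : dbar3 f2 x y z t = 0.
  by rewrite /f2 dbar3D df1 dbar3_dbar2 // addr0.
have f2d x y z : deg_ab_bc 1%N x -> deg_ab_bc 1%N y -> deg_ab_bc 1%N z ->
    exists p q r s : 'F_2, f2 x y z = quadF p q r s.
  by move=> dx dy dz; apply: deg2_quad; apply: (tri_deg _ f2c _ _ _ _ _ _ dx dy dz).
have [aba1 [aba2 [aba3 [aba4 Eaba]]]] := f2d _ _ _ deg_xa deg_xb deg_xa.
have [abc1 [abc2 [abc3 [abc4 Eabc]]]] := f2d _ _ _ deg_xa deg_xb deg_xc.
have [bab1 [bab2 [bab3 [bab4 Ebab]]]] := f2d _ _ _ deg_xb deg_xa deg_xb.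
have [bcb1 [bcb2 [bcb3 [bcb4 Ebcb]]]] := f2d _ _ _ deg_xb deg_xc deg_xb.
have [cba1 [cba2 [cba3 [cba4 Ecba]]]] := f2d _ _ _ deg_xc deg_xb deg_xa.
have [cbc1 [cbc2 [cbc3 [cbc4 Ecbc]]]] := f2d _ _ _ deg_xc deg_xb deg_xc.
have [bca1 [bca2 [bca3 [bca4 Ebca]]]] := f2d _ _ _ deg_xb deg_xc deg_xa.
have [cab1 [cab2 [cab3 [cab4 Ecab]]]] := f2d _ _ _ deg_xc deg_xa deg_xb.
have addF2 (u v w : 'F_2) : u + v = w -> u = w + v.
  by move=> <-; rewrite -addrA (_ : v + v = 0) ?addr0 // addrr_pchar2.
have [] := reduced_relations f2 f2c df2 f2r.
rewrite Eaba Eabc Ebab Ebcb Ecba Ecbc Ebca Ecab.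
(* The first four relations leave only the b^2 terms of bab and bcb and remove those of aba, abc,
   cba, cbc; the fifth equates those of bca and cab. *)
move=> [/rel_a_b[? ? ? ?] /rel_a_b[? ? ? ?] /rel_c_b[_ _ _ ?]].
move=> /rel_c_b[_ _ _ ?] /rel_b_b/addF2 cab4E.
(* The other four express cba, bca and cab, apart from b^2 terms, through aba, abc and cbc. *)
move=> [/rel_aac[/addF2 bca1E /addF2 bca2E /addF2 bca3E ?]].
move=> /rel_cac[? /esym cba1E /esym cba2E /esym cba3E].
move=> /rel_caa[cab1E _ _ _] /rel_cca[_ _ cab2E cab3E].
have {}cab2E : cab2 = cbc3 + abc2 by apply: addF2; rewrite addrC.
have {}cab3E : cab3 = 0 + abc3 by apply: addF2; rewrite addrC.
subst cab1 cba1 cba2 cba3 bca1 bca2 bca3 cab2 cab3 cab4.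
subst => {fc df f2d}.
(* With t_abc = a p1 + c p2, t_aba = a u and t_cbc = c w for linear forms p1, p2,
   u, w in a, c, the relations give t_cba = t_abc + c u + a w, and G_ab = p2,
   G_ba = p2 + u, G_bc = p1, G_cb = p1 + w solve the equations up to multiples
   of b. *)
pose G_ab := lin (sc 0) (sc abc3) (sc 0).
pose G_ba := lin (sc aba1) (sc (abc3 + aba2)) (sc bab4).
pose G_bc := lin (sc abc1) (sc abc2) (sc 0).
pose G_cb := lin (sc (abc1 + cbc2)) (sc (abc2 + cbc3)) (sc bcb4).
(* This b-term clears the b^2 terms of bca and cab at once; those of bab and bcb are cleared by the
   b-terms of [G_ba] and [G_cb]. *)
pose G_ca := lin (sc 0) (sc 0) (sc bca4).
(* Reducing the zero cochain gives a reduced coboundary whose [g2] takes the chosen values on ab,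
   cb, ba, bc, ca. *)
pose f0 (x y z : Q) : Q := 0.
have f0c : tricochain f0.
  by split=> [u v k x y|u v k x y|u v k x y|d e k x y z _ _ _];
    rewrite /f0 ?scaler0 ?addr0 //; apply: deg0.
have f0n : normalized f0 by split.
have [g2 g2c [f3r [gab gcb gba] [gbc gca gac]]] :=
  exists_reducing f0 G_ab G_cb G_ba G_bc G_ca f0c f0n
    (deg_lin _ _ _) (deg_lin _ _ _) (deg_lin _ _ _) (deg_lin _ _ _) (deg_lin _ _ _).

set d2 := (fun x y z => _) in f3r.
have d2c : tricochain d2 by apply: tricochainD => //; apply: tricochain_dbar2.
have dd2 x y z t : dbar3 d2 x y z t = 0.
  by rewrite /d2 dbar3D dbar3_dbar2 // /dbar3 /f0 !mulr0 mul0r !addr0.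
have g20l y : g2 0 y = 0 by apply: (linear_at0 (g2^~ y)) (bi_linl _ g2c y).
have g20r x : g2 x 0 = 0 by apply: linear_at0 (bi_linr _ g2c x).
have cb0 : xc * xb = 0 :> Q by rewrite mulrC mul_bc.
have ba0 : xb * xa = 0 :> Q by rewrite mulrC mul_ab.
have d2E x y z : d2 x y z = dbar2 g2 x y z by rewrite /d2 add0r.
(* The values of [g2] at (ac, b) and (b, ac) are forced by the vanishing of [d2] at (a, c, b) and
   (b, a, c). *)
have g_ac_b : g2 (xa * xc) xb = xa * G_cb.
  have := red_a _ f3r 0 1 xb; rewrite mul1r d2E /dbar2 cb0 g20r gac gcb mul0r !addr0.
  by move=> /addQ_eq0->.
have g_b_ac : g2 xb (xa * xc) = G_ba * xc.
  have := red_ba _ f3r 0 1; rewrite mul1r d2E /dbar2 ba0 g20l gac gba mulr0 !add0r.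
  by move=> /addQ_eq0->.
pose f3 x y z := f2 x y z + d2 x y z.
have f3_0 : forall x y z, f3 x y z = 0.
  apply: reduced_eq0.
  - exact: tricochainD.
  - by move=> x y z t; rewrite dbar3D df2 dd2 addr0.
  - exact: reducedD.
  - split; rewrite /f3 d2E /dbar2.
    + rewrite Eaba mul_ab ba0 g20l g20r gab gba /G_ab /G_ba /lin.
      rewrite quad.unlock ?scD !sc0.
      ring: mul_ab mul_bc two_eq0.
    + rewrite Eabc mul_ab mul_bc g20l g20r gab gbc /G_ab /G_bc /lin.
      rewrite quad.unlock ?scD !sc0.
      ring: mul_ab mul_bc two_eq0.
    + rewrite Ecba cb0 ba0 g20l g20r gcb gba /G_cb /G_ba /lin.
      rewrite quad.unlock ?scD !sc0.
      ring: mul_ab mul_bc two_eq0.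
    + rewrite Ecbc cb0 mul_bc g20l g20r gcb gbc /G_cb /G_bc /lin.
      rewrite quad.unlock ?scD !sc0.
      ring: mul_ab mul_bc two_eq0.
  - split; rewrite /f3 d2E /dbar2.
    + rewrite Ebab mul_ab ba0 g20l g20r gab gba /G_ab /G_ba /lin.
      rewrite quad.unlock ?scD !sc0.
      ring: mul_ab mul_bc two_eq0.
    + rewrite Ebcb cb0 mul_bc g20l g20r gcb gbc /G_cb /G_bc /lin.
      rewrite quad.unlock ?scD !sc0.
      ring: mul_ab mul_bc two_eq0.
    + rewrite Ebca mul_bc (mulrC xc xa) g20l g_b_ac gca gbc /G_ca /G_ba /G_bc /lin.
      rewrite quad.unlock ?scD !sc0.
      ring: mul_ab mul_bc two_eq0.
    + rewrite Ecab mul_ab (mulrC xc xa) g20r g_ac_b gca gab /G_ca /G_cb /G_ab /lin.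
      rewrite quad.unlock ?scD !sc0.
      ring: mul_ab mul_bc two_eq0.
exists (fun x y => g0 x y + (g1 x y + g2 x y)).
  by do 2 ![apply: bicochainD => //].
move=> x y z; apply: addQ_eq0; rewrite -[RHS](f3_0 x y z) /f3 d2E /f2 /f1 /dbar2.
ring.
Qed.

(** * Return to the Hochschild complex *)

Definition args (n : nat) (s : seq Q) : 'I_n -> gralg_ab_bc := fun i => nth 0 s i.

Lemma args3E (a : 'I_3 -> gralg_ab_bc) :
  a = args 3 [:: a ord0; a (lift ord0 ord0); a (lift ord0 (lift ord0 ord0))].
Proof.
by apply/funext => -[[|[|[|//]]] i]; rewrite /args /=; congr a; apply/val_inj.
Qed.

Local Notation M := (regbimod gralg_ab_bc).

Lemma hdiff2 (g : ('I_2 -> gralg_ab_bc) -> M) x y z :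
  hdiff g (args 3 [:: x; y; z]) = dbar2 (fun x y => g (args 2 [:: x; y])) x y z.
Proof.
rewrite /hdiff !big_ord_recl big_ord0 /dbar2 addr0 !addrA /=.
by congr (_ * g _ + g _ + g _ + g _ * _); apply/funext => -[[|[|//]] i].
Qed.

Lemma hdiff3 (f : ('I_3 -> gralg_ab_bc) -> M) x y z t :
  hdiff f (args 4 [:: x; y; z; t])
  = dbar3 (fun x y z => f (args 3 [:: x; y; z])) x y z t.
Proof.
rewrite /hdiff !big_ord_recl big_ord0 /dbar3 addr0 !addrA /=.
by congr (_ * f _ + f _ + f _ + f _ + f _ * _);
  apply/funext => -[[|[|[|//]]] i].
Qed.

Lemma cochain3 (f : ('I_3 -> gralg_ab_bc) -> M) :
  is_cochain (-1) f -> tricochain (fun x y z => f (args 3 [:: x; y; z])).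
Proof.
move=> [fl fd]; split.
- move=> y z k x x'.
  (* The entry 0 is a placeholder that [setarg] overwrites. *)
  have E u : args 3 [:: u; y; z] = setarg (args 3 [:: 0; y; z]) ord0 u.
    by apply/funext => -[[|[|[|//]]] i].
  by rewrite (E (_ + _)) fl (E x) (E x').
- move=> x z k y y'.
  have E u : args 3 [:: x; u; z] = setarg (args 3 [:: x; 0; z]) (lift ord0 ord0) u.
    by apply/funext => -[[|[|[|//]]] i].
  by rewrite (E (_ + _)) fl (E y) (E y').
- move=> x y k z z'.
  have E u : args 3 [:: x; y; u] = setarg (args 3 [:: x; y; 0]) ord_max u.
    by apply/funext => -[[|[|[|//]]] i].
  by rewrite (E (_ + _)) fl (E z) (E z').
- move=> d e k x y z dx dy dz.
  have H := fd (fun i => nth 0 [:: d; e; k] i) (args 3 [:: x; y; z]).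
  rewrite !big_ord_recl big_ord0 /= in H.
  apply: deg_eq (H _); first lia.
  by case=> -[|[|[|//]]] i.
Qed.

Lemma cochain2 (g : Q -> Q -> Q) : bicochain g ->
  is_cochain (-1)
    ((fun a => g (a ord0) (a (lift ord0 ord0))) : ('I_2 -> gralg_ab_bc) -> M).
Proof.
move=> [gl gr gd]; split=> [a [[|[|//]] i] k x y|d a da].
- exact: gl.
- exact: gr.
- rewrite !big_ord_recl big_ord0.
  by apply: deg_eq (gd _ _ _ _ (da _) (da _)); lia.
Qed.

Theorem theorem4p1 : forall x : HH gralg_ab_bc 3 (-1), x = 0.
Proof.
apply/HH_bimod_eq0 => f fc df.
have [] := tricocycle_dbar2 _ (cochain3 f fc).
  by move=> x y z t; rewrite -hdiff3 df.
move=> g gc fE; exists (fun a => g (a ord0) (a (lift ord0 ord0))); first exact: cochain2.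
apply/funext => a; rewrite (args3E a) hdiff2; exact: fE.
Qed.
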